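(* Let $K\ge2$ and let $p_1,\dots,p_K\in(0,1)$ and $q_1,\dots,q_K\in(0,1)$ be the limiting conditional probabilities of $\boldsymbol X$ and $\boldsymbol Y$ for a risk functional $r$ and a partition $A_1,\dots,A_K$ of $\Omega_r$ (see context), and let $\hat p_j,\hat q_j$ ($1\le j\le K$) be their empirical estimators based on rank-transformed pseudo-observations with $k_n$ exceedances (see context), where $k_n\to\infty$. Assume that, as $n\to\infty$, $$\sqrt{k_n}(\hat p_j-p_j)=N_j^X+o_P(1)\quad\text{and}\quad\sqrt{k_n}(\hat q_j-q_j)=N_j^Y+o_P(1)\qquad\text{for all }1\le j\le K,$$ where $(N_1^X,\dots,N_K^X)$ and $(N_1^Y,\dots,N_K^Y)$ are two independent normally distributed random vectors with mean zero and covariance matrices $\boldsymbol\Sigma^X$ and $\boldsymbol\Sigma^Y$. Let $$\hat D_K=\sum_{j=1}^K(\hat p_j-\hat q_j)(\log\hat p_j-\log\hat q_j),\qquad D_K=\sum_{j=1}^K(p_j-q_j)(\log p_j-\log q_j).$$ (i) If $p_j=q_j$ for all $1\le j\le K$ (null hypothesis), then $$\frac{k_n}{2}\hat D_K\ \stackrel{d}{\to}\ \sum_{j=1}^K\frac1{2p_j}\bigl(N_j^X-N_j^Y\bigr)^2,\qquad n\to\infty.$$ (ii) If $p_j\neq q_j$ for some $1\le j\le K$ (alternative hypothesis), then $$\sqrt{k_n}\bigl(\hat D_K-D_K\bigr)\ \stackrel{d}{\to}\ \sum_{j=1}^K\bigl(D_{1j}N_j^X+D_{2j}N_j^Y\bigr),\qquad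 n\to\infty,$$ where $D_{1j}=\log\frac{p_j}{q_j}+1-\frac{q_j}{p_j}$ and $D_{2j}=\log\frac{q_j}{p_j}+1-\frac{p_j}{q_j}$ for $1\le j\le K$.
   Context: Setting: $\tilde{\boldsymbol X}$ and $\tilde{\boldsymbol Y}$ are $d$-dimensional random vectors with marginal distribution functions $F_j$ and $G_j$ (unknown to the statistician). Put $X_j=1/(1-F_j(\tilde X_j))$, $Y_j=1/(1-G_j(\tilde Y_j))$, assumed to have standard Pareto margins, and assume that $\boldsymbol X=(X_1,\dots,X_d)$ and $\boldsymbol Y=(Y_1,\dots,Y_d)$ are multivariate regularly varying, i.e. there is a probability measure $\nu_X$ on $\{\boldsymbol x\ge 0:\|\boldsymbol x\|_\infty>1\}$ with $\lim_{u\to\infty}\mathbb P(\boldsymbol X/u\in B\mid\|\boldsymbol X\|_\infty>u)=\nu_X(B)$ for all Borel $B\subset\{\boldsymbol x\ge0:\|\boldsymbol x\|_\infty>1\}$ with $\nu_X(\partial B)=0$, and similarly for $\boldsymbol Y$. Risk functional: a measurable $r:[0,\infty)^d\to[0,\infty)$ with $r(t\boldsymbol x)=t\,r(\boldsymbol x)$ for $t>0$, such that $\Omega_r=\{\boldsymbol x\in[0,\infty)^d:r(\boldsymbol x)>1\}$ is bounded away from the origin. $A_1,\dots,A_K$ is a partition of $\Omega_r$ into Borel sets, and $$p_j=\lim_{u\to\infty}\mathbb P(\boldsymbol X\in uA_j\mid r(\boldsymbol X)>u)\in(0,1),\qquad q_j=\lim_{u\to\infty}\mathbb P(\boldsymbol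 Y\in uA_j\mid r(\boldsymbol Y)>u)\in(0,1),$$ which are assumed to exist. Estimators: from i.i.d. samples $\tilde{\boldsymbol X}_1,\dots,\tilde{\boldsymbol X}_n$ of $\tilde{\boldsymbol X}$, form pseudo-observations $\hat{\boldsymbol X}_i=(\hat X_{i1},\dots,\hat X_{id})$ with $\hat X_{ij}=\frac{n+1}{n+1-\mathrm{rank}(\tilde X_{ij})}$, where $\mathrm{rank}(\tilde X_{ij})$ is the rank of $\tilde X_{ij}$ among $\tilde X_{1j},\dots,\tilde X_{nj}$. With $R_{1,n}\le\dots\le R_{n,n}$ the order statistics of $r(\hat{\boldsymbol X}_1),\dots,r(\hat{\boldsymbol X}_n)$, set $\hat p_j=\frac1{k_n}\sum_{i=1}^n\mathbf 1\{\hat{\boldsymbol X}_i\in R_{n-k_n,n}A_j\}$. The $\hat q_j$ are defined in the same way from an i.i.d. sample $\tilde{\boldsymbol Y}_1,\dots,\tilde{\boldsymbol Y}_n$ of $\tilde{\boldsymbol Y}$, independent of the first sample. On the event that some $\hat p_j$ or $\hat q_j$ vanishes, $\hat D_K$ may be assigned an arbitrary value. *)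

(* Defs.v *)
From HB Require Import structures.
From mathcomp Require Import all_boot all_order all_algebra.
From mathcomp Require Import all_classical all_reals all_analysis.

Set Implicit Arguments.
Unset Strict Implicit.
Unset Printing Implicit Defensive.

Import Order.TTheory GRing.Theory Num.Theory.
Import numFieldNormedType.Exports.

Local Open Scope classical_set_scope.
Local Open Scope ring_scope.

(* Matrices, hence the space 'rV[R]_d, carry the Borel sigma-algebra of their
   norm topology.  The norm `|x| of x : 'rV[R]_d is the sup norm. *)
HB.instance Definition _ (R : realType) (m n : nat) :=
  @isMeasurable.Build (sigma_display (@open 'M[R]_(m, n))) 'M[R]_(m, n)
    <<s @open 'M[R]_(m, n) >> (@sigma_algebra0 _ setT _) (@sigma_algebraC _ _)
    (@sigma_algebra_bigcup _ setT _).

Definition rv_coord (R : realType) d (j : 'I_d) (x : 'rV[R]_d) : R := x 0 j.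

Lemma measurable_rv_coord (R : realType) d (j : 'I_d) :
  measurable_fun [set: 'rV[R]_d] (rv_coord j).
Proof.
apply: (measurability _ (measurable_realfun.RGenOInfty.measurableE R)).
move=> _ [_ [x ->] <-]; rewrite setTI; apply: sub_sigma_algebra.
rewrite set_itvoy.
apply: open_comp; last exact: open_gt.
by move=> M _; exact: coord_continuous.
Qed.

HB.instance Definition _ (R : realType) d (j : 'I_d) :=
  isMeasurableFun.Build _ _ 'rV[R]_d R (rv_coord j) (measurable_rv_coord j).

Section probability_notions.
Context {R : realType} {disp : measure_display} {T : measurableType disp}.
Context (P : probability T R).

Definition coord_rv d (X : {RV P >-> 'rV[R]_d}) (j : 'I_d) : {RV P >-> R} :=
  rv_coord j \o X.

Definition cond_prob (A B : set T) : R := fine (P (A `&` B)) / fine (P B).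

Definition same_law disp' (V : measurableType disp') (X Y : {RV P >-> V}) :=
  forall B, measurable B -> distribution P X B = distribution P Y B.

(* Taking some of the B i to be setT gives the product rule for subfamilies. *)
Definition mutually_independent disp' (V : measurableType disp') (I : finType)
    (X : I -> {RV P >-> V}) :=
  forall B : I -> set V, (forall i, measurable (B i)) ->
    P (\bigcap_i (X i @^-1` B i)) = (\prod_i P (X i @^-1` B i))%E.

Definition independent_vectors disp1 disp2 (V1 : measurableType disp1)
    (V2 : measurableType disp2) (X : {RV P >-> V1}) (Y : {RV P >-> V2}) :=
  forall A B, measurable A -> measurable B ->
    P (X @^-1` A `&` Y @^-1` B) = (P (X @^-1` A) * P (Y @^-1` B))%E.

(* The library's normal_prob m 0 is not the point mass at m, hence the case
   distinction; degenerate normal laws are allowed. *)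
Definition normal_variable (Z : T -> R) :=
  measurable_fun setT Z /\
  exists m s : R, forall B, measurable B ->
    P (Z @^-1` B) = if s == 0 then \d_m B else normal_prob m s B.

(* A random vector is normal when all linear combinations of its coordinates
   are; its covariance matrix may be singular. *)
Definition centered_normal_vector K (N : {RV P >-> 'rV[R]_K})
    (Sigma : 'M[R]_K) :=
  [/\ forall a : 'I_K -> R, normal_variable (fun w => \sum_j a j * N w 0 j),
      forall j, ('E_P[coord_rv N j] = 0)%E &
      forall i j, covariance P (coord_rv N i) (coord_rv N j) = (Sigma i j)%:E].

Definition o_P1 (Z : nat -> T -> R) :=
  forall e : R, 0 < e -> P [set w | e <= `|Z n w|] @[n --> \oo] --> 0%E.

(* Convergence of the distribution functions at the continuity points of the
   limiting one. *)
Definition cvg_in_distribution (Z : nat -> T -> R) (W : T -> R) :=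
  let df (V : T -> R) (x : R) := P [set w | V w <= x] in
  [/\ forall n, measurable_fun setT (Z n),
      measurable_fun setT W &
      forall x : R, {for x, continuous (df W)} ->
        df (Z n) x @[n --> \oo] --> df W x].

End probability_notions.

Section extremes.
Context {R : realType} {d : nat}.
Implicit Types (r : 'rV[R]_d -> R) (A B E : set 'rV[R]_d).

Definition orthant : set 'rV[R]_d := [set x | forall j, 0 <= x 0 j].

Definition orthant_exterior : set 'rV[R]_d := [set x | orthant x /\ 1 < `|x|].

(* Boundary of B relative to the subspace E. *)
Definition boundary_in E B := E `&` closure B `&` closure (E `\` B).

Definition dilate (u : R) A : set 'rV[R]_d := [set u *: x | x in A].

Definition exceedance_set r : set 'rV[R]_d := [set x | orthant x /\ 1 < r x].

(* Only the values of r on the orthant matter. *)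
Definition risk_functional r :=
  [/\ measurable_fun orthant r,
      forall x, orthant x -> 0 <= r x,
      forall (t : R) x, 0 < t -> orthant x -> r (t *: x) = t * r x &
      exists2 e : R, 0 < e & forall x, exceedance_set r x -> e <= `|x|].

Definition borel_partition K (A : 'I_K -> set 'rV[R]_d) E :=
  [/\ forall j, measurable (A j), trivIset setT A & \bigcup_j A j = E].

Context {disp : measure_display} {T : measurableType disp}.
Context (P : probability T R).

(* The vector with coordinates 1 / (1 - F_j(X_j)), F_j the j-th marginal
   distribution function of X. *)
Definition pareto_transform (X : {RV P >-> 'rV[R]_d}) (w : T) : 'rV[R]_d :=
  \row_j (1 - fine (cdf (coord_rv X j) (X w 0 j)))^-1.

Definition standard_pareto_margins (X : T -> 'rV[R]_d) :=
  forall j (x : R),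
    P [set w | X w 0 j <= x] = (if 1 <= x then 1 - x^-1 else 0)%:E.

Definition regularly_varying (X : T -> 'rV[R]_d) :=
  exists2 nu : probability 'rV[R]_d R, nu orthant_exterior = 1%E &
    forall B, measurable B -> B `<=` orthant_exterior ->
      nu (boundary_in orthant_exterior B) = 0%E ->
      cond_prob P [set w | B (u^-1 *: X w)] [set w | u < `|X w|]
        @[u --> +oo] --> fine (nu B).

Definition tail_limit r A (X : T -> 'rV[R]_d) (p : R) :=
  cond_prob P [set w | dilate u A (X w)] [set w | u < r (X w)]
    @[u --> +oo] --> p.

(* The data are s i, i < n.  Ties, which have probability zero under
   continuous margins, are given the maximal rank. *)
Section estimator.
Context {n : nat}.
Implicit Type s : 'I_n -> 'rV[R]_d.

Definition data_rank s (i : 'I_n) (j : 'I_d) : nat :=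
  #|[set l | s l 0 j <= s i 0 j]%SET|.

Definition pseudo_obs s (i : 'I_n) : 'rV[R]_d :=
  \row_j (n.+1%:R / (n.+1 - data_rank s i j)%:R).

(* The m-th smallest entry of t, for 1 <= m <= size t. *)
Definition order_stat (t : seq R) (m : nat) : R :=
  nth 0 (sort (fun x y => x <= y) t) m.-1.

Definition empirical_prob r A (k : nat) s : R :=
  let threshold := order_stat [seq r (pseudo_obs s i) | i : 'I_n] (n - k) in
  k%:R^-1 * \sum_(i < n) \1_(dilate threshold A) (pseudo_obs s i).

End estimator.

End extremes.

Definition sym_divergence (R : realType) K (p q : 'I_K -> R) : R :=
  \sum_j (p j - q j) * (ln (p j) - ln (q j)).

(* Main.v *)
(* Delta method. The limits N^X, N^Y live on the same probability space as the
   estimators, so it suffices to prove convergence in probability. With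
   s = sqrt k, a = s (phat - p) and b = s (qhat - q), each summand is governed
   by s (ln phat - ln p) = a / p + O(a^2 / s): for p = q,
     s^2 (phat - qhat)(ln phat - ln qhat) ~ (a - b)(a / p - b / p),
   and in general s times the increment of (phat - qhat)(ln phat - ln qhat) is
     ~ (a - b)(ln p - ln q) + (p - q)(a / p - b / q).
   Convergence in probability is convergence along a filter on nat * T; on the
   events {sum_j |N^X_j| + |N^Y_j| <= M} everything is bounded and these
   expansions are ordinary limits along that filter, and tightness removes M. *)
Require Import Defs.
From HB Require Import structures.
From mathcomp Require Import all_boot all_order all_algebra.
From mathcomp Require Import ring lra.
From mathcomp Require Import all_classical all_reals all_analysis.
From mathcomp Require Import measurable_realfun.

Set Implicit Arguments.
Unset Strict Implicit.
Unset Printing Implicit Defensive.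

Import Order.TTheory GRing.Theory Num.Theory.
Import numFieldNormedType.Exports.

Local Open Scope classical_set_scope.
Local Open Scope ring_scope.

(** * Calculus of asymptotic equivalence along a filter *)

Section asymptotic_expansion.
Context {R : realType} {S : Type} (F : set_system S) {FF : Filter F}.
Implicit Types u v U V s : S -> R.

(** Boundedness of the target [U] is built in because a vanishing difference is not by itself
    preserved by products. *)
Definition tracks u U :=
  (u x - U x @[x --> F] --> 0) /\
  exists M : R, \forall x \near F, `|U x| <= M.

Lemma near_eq_tracks u v U V : (\forall x \near F, u x = v x) -> U =1 V ->
  tracks u U -> tracks v V.
Proof.
move=> uv UV [uU [M UM]]; split.
- apply: cvg_trans uU; apply: near_eq_cvg.
  by near=> x; rewrite -UV; congr (_ - _); near: x.
- by exists M; apply: filterS UM => x; rewrite -UV.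
Unshelve. all: by end_near. Qed.

Lemma tracks_cst (c : R) : tracks (cst c) (cst c).
Proof.
split; last by exists `|c|; apply: nearW.
by under eq_fun do rewrite subrr; exact: cvg_cst.
Qed.

Lemma tracksD u v U V : tracks u U -> tracks v V -> tracks (u \+ v) (U \+ V).
Proof.
move=> [uU [M UM]] [vV [N VN]]; split.
- under eq_fun do rewrite /= opprD addrACA.
  by rewrite -[0](addr0 0); exact: cvgD.
- exists (M + N); near=> x.
  by apply: le_trans (ler_normD _ _) _; apply: lerD; near: x.
Unshelve. all: by end_near. Qed.

Lemma cvg0M_bounded u U (M : R) : u x @[x --> F] --> 0 ->
  (\forall x \near F, `|U x| <= M) -> u x * U x @[x --> F] --> 0.
Proof.
move=> u0 UM; apply: norm_cvg0.
apply: (@squeeze_cvgr _ _ _ _ (cst 0) (fun x => `|u x| * M)).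
- near=> x; rewrite normr_ge0 normrM ler_wpM2l//; near: x; exact: UM.
- exact: cvg_cst.
- by rewrite -(mul0r M) -(normr0 R); apply: cvgMr_tmp; exact: cvg_norm.
Unshelve. all: by end_near. Qed.

Lemma tracksM u v U V : tracks u U -> tracks v V -> tracks (u \* v) (U \* V).
Proof.
move=> [uU [M UM]] [vV [N VN]]; split.
(* Each term is a null factor times a null or a bounded one. *)
- have -> : (fun x => (u \* v) x - (U \* V) x) =
      (fun x => (u x - U x) * (v x - V x) + (u x - U x) * V x +
                (v x - V x) * U x) by apply/funext => x /=; ring.
  rewrite -[0](addr0 0) -[X in X + _](addr0 0).
  apply: cvgD; last exact: cvg0M_bounded UM.
  apply: cvgD; last exact: cvg0M_bounded VN.
  by rewrite -[0](mulr0 0); exact: cvgM.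
- exists (M * N); near=> x.
  by rewrite normrM ler_pM//; near: x.
Unshelve. all: by end_near. Qed.

Lemma tracksZ (c : R) u U :
  tracks u U -> tracks (fun x => c * u x) (fun x => c * U x).
Proof. exact: tracksM (tracks_cst c). Qed.

Lemma tracksB u v U V : tracks u U -> tracks v V ->
  tracks (fun x => u x - v x) (fun x => U x - V x).
Proof.
move=> uU /(tracksZ (-1)) /(tracksD uU).
by apply: near_eq_tracks => [|x]; [apply: nearW => x|]; rewrite /= mulN1r.
Qed.

Lemma tracks_sum (I : Type) (r : seq I) (u U : I -> S -> R) :
  (forall i, tracks (u i) (U i)) ->
  tracks (fun x => \sum_(i <- r) u i x) (fun x => \sum_(i <- r) U i x).
Proof.
move=> uU; elim: r => [|i r IHr].
  by apply: near_eq_tracks (tracks_cst 0) => [|x];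
    [apply: nearW => x|]; rewrite big_nil.
by apply: near_eq_tracks (tracksD (uU i) IHr) => [|x];
    [apply: nearW => x|]; rewrite big_cons.
Qed.

(** Both bounds come from [ln (1 + x) <= x]: the upper one at [x = t], the lower one at
    [x = - t / (1 + t)], where [1 + x] is the inverse of [1 + t]. The lower one reduces to
    [0 <= t ^+ 2 * (1 + 2 * t)], whence the range of [t]. *)
Lemma ln1D_bound (t : R) : -2^-1 <= t -> `|ln (1 + t) - t| <= 2 * t ^+ 2.
Proof.
move=> t_ge; have t1 : 0 < 1 + t by lra.
have : ln (1 + t) <= t by apply: le_ln1Dx; lra.
have : ln (1 + (- t / (1 + t))) <= - t / (1 + t).
  by apply: le_ln1Dx; rewrite ltr_pdivlMr//; lra.
have -> : 1 + - t / (1 + t) = (1 + t)^-1 by field; rewrite gt_eqF.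
rewrite lnV ?posrE// => lb ub.
rewrite ler_norml; apply/andP; split; last by have := sqr_ge0 t; lra.
have : - t / (1 + t) <= - t + 2 * t ^+ 2; last by lra.
rewrite ler_pdivrMr//.
suff : 0 <= t ^+ 2 * (1 + 2 * t) by lra.
by rewrite mulr_ge0 ?sqr_ge0//; lra.
Qed.

(** * Logarithm and divergence expanded at a diverging scale [s] *)

Context (s : S -> R).
Hypothesis s_gt0 : \forall x \near F, 0 < s x.
Hypothesis sV0 : (s x)^-1 @[x --> F] --> 0.

(** Consistency follows from the rate: [u - p] is the null factor [s^-1] times a quantity that stays
    bounded. *)
Lemma tracks_scaled_cvg u U (p : R) :
  tracks (fun x => s x * (u x - p)) U -> tracks u (cst p).
Proof.
move=> uU; have /tracksM/(_ uU) : tracks (fun x => (s x)^-1) (cst 0).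
  split; first by under eq_fun do rewrite subr0.
  by exists 0; apply: nearW => x; rewrite normr0.
move=> /tracksD/(_ (tracks_cst p)).
apply: near_eq_tracks => [|x]; last by rewrite /= mul0r add0r.
near=> x => /=; rewrite mulKf ?subrK// gt_eqF//; near: x; exact: s_gt0.
Unshelve. all: by end_near. Qed.

Lemma tracks_gt0 u (p : R) : 0 < p -> tracks u (cst p) ->
  \forall x \near F, 0 < u x.
Proof.
move=> p0 [+ _] => /cvgr0_norm_lt/(_ _ p0).
by apply: filterS => x; rewrite ltr_norml /=; lra.
Qed.

Lemma tracks_ln u U (p : R) : 0 < p ->
  tracks (fun x => s x * (u x - p)) U ->
  tracks (fun x => s x * (ln (u x) - ln p)) (fun x => p^-1 * U x).
Proof.
move=> p0 uU; have up := tracks_scaled_cvg uU.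
(* The quadratic remainder 2 s ((u - p) / p)^2 tends to 0. *)
have /tracksM/(_ uU)[+ _] := tracksB up (tracks_cst p).
rewrite /= subrr; under eq_fun do rewrite mul0r subr0.
move=> /(cvgMr_tmp (b := 2 / p ^+ 2)); rewrite mul0r => quad0.
have [pU0 pUM] := tracksZ p^-1 uU; split => //.
rewrite -[0](addr0 0).
have -> : (fun x => s x * (ln (u x) - ln p) - p^-1 * U x) =
    (fun x => (s x * (ln (u x) - ln p) - p^-1 * (s x * (u x - p))) +
              (p^-1 * (s x * (u x - p)) - p^-1 * U x)).
  by apply/funext => x; rewrite addrA subrK.
apply: cvgD pU0; apply: norm_cvg0.
apply: (@squeeze_cvgr _ _ _ _ (cst 0)); [|exact: cvg_cst|exact: quad0].
near=> x; rewrite normr_ge0/=.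
have sx0 : 0 < s x by near: x.
have ux0 : 0 < u x by near: x; exact: tracks_gt0 up.
set t := (u x - p) / p.
have uE : u x = p * (1 + t) by rewrite /t; field; rewrite gt_eqF.
have upE : u x - p = p * t by rewrite /t; field; rewrite gt_eqF.
(* The range required by [ln1D_bound], reached eventually since [u] tends to [p > 0]. *)
have t_ge : - 2^-1 <= t.
  have : `|u x - p| < p / 2.
    by near: x; apply: cvgr0_norm_lt; [case: up|rewrite divr_gt0].
  by rewrite upE normrM gtr0_norm// ltr_pM2l// ltr_norml; lra.
have t1 : 0 < 1 + t by lra.
rewrite upE uE lnM ?posrE// [ln p + _]addrC addrK.
have -> : s x * ln (1 + t) - p^-1 * (s x * (p * t)) = s x * (ln (1 + t) - t).
  by field; rewrite gt_eqF.
have -> : p * t * (s x * (p * t)) * (2 / p ^+ 2) = s x * (2 * t ^+ 2).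
  by field; rewrite gt_eqF.
by rewrite normrM gtr0_norm// ler_pM2l// ln1D_bound.
Unshelve. all: by end_near. Qed.

(** With a common [p] the centrings cancel in [phat - qhat] and in [ln phat - ln qhat], so each of
    these two factors absorbs one power of [s]. *)
Lemma tracks_sym_divergence_null K (p : 'I_K -> R)
    (phat qhat U V : 'I_K -> S -> R) :
  (forall j, 0 < p j) ->
  (forall j, tracks (fun x => s x * (phat j x - p j)) (U j)) ->
  (forall j, tracks (fun x => s x * (qhat j x - p j)) (V j)) ->
  tracks (fun x => s x ^+ 2 / 2 * sym_divergence (phat ^~ x) (qhat ^~ x))
         (fun x => \sum_j (2 * p j)^-1 * (U j x - V j x) ^+ 2).
Proof.
move=> p0 pU qV.
have := tracks_sum (index_enum 'I_K) (fun j => tracksZ 2^-1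
  (tracksM (tracksB (pU j) (qV j))
           (tracksB (tracks_ln (p0 j) (pU j)) (tracks_ln (p0 j) (qV j))))).
apply: near_eq_tracks => [|x] /=.
- apply: nearW => x; rewrite /sym_divergence mulr_sumr.
  by apply: eq_bigr => j _; field.
- by apply: eq_bigr => j _; field; rewrite gt_eqF.
Qed.

(** The increment of each summand is exactly [((phat - p) - (qhat - q)) (ln phat - ln qhat) + (p -
    q) ((ln phat - ln p) - (ln qhat - ln q))]. The logarithms enter the first term only through
    their limits, the second through their scaled errors. *)
Lemma tracks_sym_divergence_alt K (p q : 'I_K -> R)
    (phat qhat U V : 'I_K -> S -> R) :
  (forall j, 0 < p j) -> (forall j, 0 < q j) ->
  (forall j, tracks (fun x => s x * (phat j x - p j)) (U j)) ->
  (forall j, tracks (fun x => s x * (qhat j x - q j)) (V j)) ->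
  tracks (fun x => s x *
            (sym_divergence (phat ^~ x) (qhat ^~ x) - sym_divergence p q))
         (fun x => \sum_j ((ln (p j / q j) + 1 - q j / p j) * U j x +
                           (ln (q j / p j) + 1 - p j / q j) * V j x)).
Proof.
move=> p0 q0 pU qV.
have lnp j := tracks_ln (p0 j) (pU j).
have lnq j := tracks_ln (q0 j) (qV j).
have lnp0 j := tracks_scaled_cvg (lnp j).
have lnq0 j := tracks_scaled_cvg (lnq j).
have := tracks_sum (index_enum 'I_K) (fun j => tracksD
  (tracksM (tracksB (pU j) (qV j)) (tracksB (lnp0 j) (lnq0 j)))
  (tracksZ (p j - q j) (tracksB (lnp j) (lnq j)))).
apply: near_eq_tracks => [|x] /=.
- apply: nearW => x; rewrite /sym_divergence -sumrB mulr_sumr.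
  by apply: eq_bigr => j _; ring.
- apply: eq_bigr => j _; rewrite !ln_div ?posrE//.
  by field; rewrite !gt_eqF.
Qed.

End asymptotic_expansion.

(** * Convergence in probability as a filter, and passage to convergence in law *)

Section high_probability.
Context {R : realType} {disp : measure_display} {T : measurableType disp}.
Context (P : probability T R).

(* Convergence along the filter [whp] is convergence in outer probability.
   The property is wrapped in an inductive type so that tactics do not unfold
   [whp S] into a product. *)
Variant likely (S : set (nat * T)) : Prop := Likely of forall e : R, 0 < e ->
  \forall n \near \oo, exists E,
    [/\ measurable E, (P E <= e%:E)%E & forall w, ~ E w -> S (n, w)].

Definition whp : set_system (nat * T) := likely.

#[global] Instance whp_filter : Filter whp.
Proof.
split.
- by split=> e e0; apply: nearW => n; exists set0; split => //;
    rewrite measure0 lee_fin ltW.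
- move=> S1 S2 [P1] [P2]; split=> e e0.
  have e20 : 0 < e / 2 by rewrite divr_gt0.
  apply: filterS2 (P1 _ e20) (P2 _ e20) => n [E1 [mE1 PE1 S1E]]
    [E2 [mE2 PE2 S2E]].
  exists (E1 `|` E2); split; first exact: measurableU.
  + by rewrite (le_trans (measureU2 _ _ _))// [e]splitr EFinD leeD.
  + by move=> w /not_orP[? ?]; split; [exact: S1E|exact: S2E].
- move=> S1 S2 S12 [P1]; split=> e /P1; apply: filterS => n [E [mE PE S1E]].
  by exists E; split=> // w /S1E /S12.
Qed.

Lemma cvg_fst_whp : fst @ whp --> \oo.
Proof.
by move=> S nS; split=> e e0; apply: filterS nS => n Sn;
  exists set0; split => //;
  rewrite measure0 lee_fin ltW.
Qed.

(* [P] is a junk value on nonmeasurable sets, hence the first hypothesis. *)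
Lemma o_P1_cvg_whp (Z : nat -> T -> R) :
  (forall n, measurable_fun setT (Z n)) -> o_P1 P Z -> Z x.1 x.2 @[x --> whp] --> 0.
Proof.
move=> mZ ZP; apply/cvgr0Pnorm_lt => e e0; split=> c c0.
have := ZP _ e0 => /fine_cvgP[fin /cvgr0_norm_lt/(_ _ c0)].
move=> /(filterI fin); apply: filterS => n [finn Pn].
exists [set w | e <= `|Z n w|]; split.
- rewrite -[X in measurable X]setTI.
  apply: (measurable_fun_le (f := cst e) (g := fun w => `|Z n w|)) => //.
  exact: measurableT_comp.
- rewrite -(fineK finn) lee_fin ltW//.
  exact: le_lt_trans (ler_norm _) Pn.
- by move=> w /= /negP; rewrite -ltNge.
Qed.

Lemma tight (g : T -> R) (e : R) : measurable_fun setT g -> 0 < e ->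
  exists M : R, exists E,
    [/\ measurable E, (P E <= e%:E)%E & forall w, ~ E w -> g w <= M].
Proof.
move=> mg e0.
pose X : {RV P >-> R} := HB.pack g (isMeasurableFun.Build _ _ _ _ g mg).
have /fine_cvgP[fin /cvgr0_norm_lt/(_ _ e0)] := cvg_ccdfy0 X.
move=> /(filterI fin)/filter_ex[M [finM PM]].
exists M, (X @^-1` `]M, +oo[); split.
- exact: measurable_funPTI.
- rewrite [P _](_ : _ = ccdf X M)// -(fineK finM) lee_fin ltW//.
  exact: le_lt_trans (ler_norm _) PM.
- by move=> w /= /negP; rewrite in_itv/= andbT -leNgt.
Qed.

(** Tightness fixes [M] from the tolerance [c] alone, before [n]; one half of [c] pays for the tail
    of [g], the other for the exceptional event at level [M]. *)
Lemma cvg_whp_within (Z : nat -> T -> R) (W g : T -> R) :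
  measurable_fun setT g ->
  (forall M : R, Z x.1 x.2 - W x.2
     @[x --> within [set x : nat * T | g x.2 <= M] whp] --> 0) ->
  Z x.1 x.2 - W x.2 @[x --> whp] --> 0.
Proof.
move=> mg ZW; apply/cvgr0Pnorm_lt => e e0; split=> c c0.
have c20 : 0 < c / 2 by rewrite divr_gt0.
have [M [E' [mE' PE' gM]]] := tight mg c20.
have /cvgr0Pnorm_lt/(_ e e0)[/(_ _ c20)] := ZW M.
apply: filterS => n [E [mE PE ZE]].
exists (E `|` E'); split; first exact: measurableU.
- by rewrite (le_trans (measureU2 _ _ _))// [c]splitr EFinD leeD.
- by move=> w /not_orP[/ZE + /gM]; exact.
Qed.

(** Outside an event [E] of probability at most [e / 2], [Z n] and [W] differ by less than [h / 2].
    Hence the distribution function of [Z n] at [x] lies, up to [P E], between those of [W] at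
    [x - h / 2] and [x + h / 2], which continuity at [x] controls. *)
Lemma cvg_whp_in_distribution (Z : nat -> T -> R) (W : T -> R) :
  (forall n, measurable_fun setT (Z n)) -> measurable_fun setT W ->
  Z x.1 x.2 - W x.2 @[x --> whp] --> 0 ->
  cvg_in_distribution P Z W.
Proof.
move=> mZ mW ZW; split=> // x; rewrite /= => contW.
have mle (V : T -> R) y :
    measurable_fun setT V -> measurable [set w | V w <= y].
  move=> mV; rewrite -[X in measurable X]setTI.
  exact: (measurable_fun_le (g := cst y)).
have fin E : measurable E -> P E \is a fin_num
  by move=> ?; exact: fin_num_measure.
set F : R -> \bar R := fun x => P [set w | W w <= x] in contW *.
have finF y : F y \is a fin_num by apply: fin; exact: mle.
rewrite -/(F x) -(fineK (finF x)); apply/fine_cvgP; split.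
  by apply: nearW => n; apply: fin; exact: mle.
apply/cvgrPdist_le => e e0.
have e20 : 0 < e / 2 by rewrite divr_gt0.
have : F y @[y --> x] --> (fine (F x))%:E by rewrite fineK.
move=> /fine_cvg/cvgrPdist_le/(_ _ e20)/nbhs_ballP[h /= h0 hF].
have h20 : 0 < h / 2 by rewrite divr_gt0.
have Fp : `|fine (F x) - fine (F (x + h / 2))| <= e / 2.
  apply: hF; rewrite /ball/= opprD addrA subrr sub0r normrN gtr0_norm//; lra.
have Fm : `|fine (F x) - fine (F (x - h / 2))| <= e / 2.
  apply: hF; rewrite /ball/= opprB addrCA subrr addr0 gtr0_norm//; lra.
have /cvgr0Pnorm_lt/(_ _ h20)[/(_ _ e20)] := ZW.
apply: filterS => n [E [mE PE ZE]].
have finE := fin _ mE.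
move: PE; rewrite -(fineK finE) lee_fin => PE.
have sub (V1 V2 : T -> R) y1 y2 :
    measurable_fun setT V1 -> measurable_fun setT V2 ->
    (forall w, ~ E w -> V1 w <= y1 -> V2 w <= y2) ->
    fine (P [set w | V1 w <= y1]) <= fine (P [set w | V2 w <= y2]) + fine (P E).
  move=> mV1 mV2 V12; rewrite -lee_fin EFinD !fineK//;
    try by apply: fin; exact: mle.
  apply: (@le_trans _ _ (P ([set w | V2 w <= y2] `|` E))).
    apply: le_measure; rewrite ?inE; [exact: mle| |];
      first by apply: measurableU => //; exact: mle.
    move=> w V1w; have [Ew|Ew] := pselect (E w); first by right.
    by left; exact: V12.
  by apply: measureU2 => //; exact: mle.
have upper : fine (P [set w | Z n w <= x]) <= fine (F (x + h / 2)) + fine (P E).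
  apply: sub => // w /ZE /=; rewrite ltr_norml; lra.
have lower : fine (F (x - h / 2)) <= fine (P [set w | Z n w <= x]) + fine (P E).
  apply: sub => // w /ZE /=; rewrite ltr_norml; lra.
move: Fp Fm; rewrite !ler_norml /=; lra.
Qed.

Lemma tracks_within_in_distribution (Z : nat -> T -> R) (W g : T -> R) :
  (forall n, measurable_fun setT (Z n)) -> measurable_fun setT W ->
  measurable_fun setT g ->
  (forall M : R, tracks (within [set x : nat * T | g x.2 <= M] whp)
                        (fun x => Z x.1 x.2) (fun x => W x.2)) ->
  cvg_in_distribution P Z W.
Proof.
move=> mZ mW mg ZW; apply: cvg_whp_in_distribution => //.
by apply: (cvg_whp_within (Z := Z) mg) => M; case: (ZW M).
Qed.

(** Since [f] factors through [c], its preimages are finite unions of fibres of [c]. *)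
Lemma measurable_finite_factor (C : finType) (c : T -> C) (f : T -> R) :
  (forall a, measurable (c @^-1` [set a])) ->
  (forall w w', c w = c w' -> f w = f w') -> measurable_fun setT f.
Proof.
move=> mc cf _ B mB; rewrite setTI.
have -> : f @^-1` B =
    \bigcup_(a in [set a | exists2 w, c w = a & B (f w)]) (c @^-1` [set a]).
  apply/seteqP; split=> [w Bw|w [a [w' <- Bw'] /= cw]].
    by exists (c w) => //; exists w.
  by rewrite /preimage/= (cf _ _ cw).
by apply: fin_bigcup_measurable => //; exact: finite_finset.
Qed.

(* The estimator depends only on the finite pattern of pairwise comparisons of
   the data; the dependence on [r] and [A] is arbitrary. *)
Lemma measurable_empirical_prob d n (X : 'I_n -> {RV P >-> 'rV[R]_d})
    (r : 'rV[R]_d -> R) (A : set 'rV[R]_d) k :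
  measurable_fun setT (fun w => empirical_prob r A k (fun i => X i w)).
Proof.
pose c w : {ffun 'I_n * 'I_n * 'I_d -> bool} :=
  [ffun x => X x.1.1 w 0 x.2 <= X x.1.2 w 0 x.2].
apply: (measurable_finite_factor (c := c)) => [a|w w' cw].
- have -> : c @^-1` [set a] = \bigcap_x
      [set w | (coord_rv (X x.1.1) x.2 w <= coord_rv (X x.1.2) x.2 w) = a x].
    apply/seteqP; split=> [w /= <- x _ /=|w cw]; first by rewrite ffunE.
    by apply/ffunP => x; rewrite ffunE; exact: cw.
  apply: fin_bigcap_measurable => [|x _]; first exact: finite_finset.
  rewrite -[X in measurable X]setTI.
  have mle : measurable_fun setT (fun w =>
      coord_rv (X x.1.1) x.2 w <= coord_rv (X x.1.2) x.2 w).
    exact: measurable_fun_ler.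
  exact: (mle measurableT [set a x]).
(* Ranks count comparisons recorded in [c], so equal patterns give equal pseudo-observations. *)
- have obsE : pseudo_obs (fun i => X i w) = pseudo_obs (fun i => X i w').
    apply/funext => i; apply/rowP => j; rewrite !mxE /data_rank.
    congr (_ / (_ - _)%:R); apply: eq_card => l; rewrite !inE.
    by have /ffunP/(_ (l, i, j)) := cw; rewrite !ffunE.
  by rewrite /empirical_prob obsE.
Qed.

End high_probability.

(** * Assembly of the two limit laws *)

Theorem theorem3 (R : realType) (disp : measure_display)
  (T : measurableType disp) (P : probability T R) (d K : nat)
  (* populations *)
  (Xt Yt : {RV P >-> 'rV[R]_d})
  (* risk functional, partition, limiting probabilities *)
  (r : 'rV[R]_d -> R) (A : 'I_K -> set 'rV[R]_d) (p q : 'I_K -> R)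
  (* samples of size n, for every n *)
  (X Y : forall n : nat, 'I_n -> {RV P >-> 'rV[R]_d})
  (k : nat -> nat)
  (NX NY : {RV P >-> 'rV[R]_K}) (SigmaX SigmaY : 'M[R]_K)
  (Dhat : nat -> {RV P >-> R}) :
  let phat n j w := empirical_prob r (A j) (k n) (fun i => X n i w) in
  let qhat n j w := empirical_prob r (A j) (k n) (fun i => Y n i w) in
  let D := sym_divergence p q in
  let D1 j := ln (p j / q j) + 1 - q j / p j in
  let D2 j := ln (q j / p j) + 1 - p j / q j in
  (2 <= K)%N ->
  standard_pareto_margins P (pareto_transform Xt) ->
  standard_pareto_margins P (pareto_transform Yt) ->
  regularly_varying P (pareto_transform Xt) ->
  regularly_varying P (pareto_transform Yt) ->
  risk_functional r ->
  borel_partition A (exceedance_set r) ->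
  (forall j, 0 < p j < 1) ->
  (forall j, 0 < q j < 1) ->
  (forall j, tail_limit P r (A j) (pareto_transform Xt) (p j)) ->
  (forall j, tail_limit P r (A j) (pareto_transform Yt) (q j)) ->
  (forall n i, same_law (X n i) Xt) ->
  (forall n i, same_law (Y n i) Yt) ->
  (forall n, mutually_independent (fun i : 'I_n + 'I_n =>
     match i with inl a => X n a | inr b => Y n b end)) ->
  k @ \oo --> \oo ->
  (\forall n \near \oo, (k n < n)%N) ->
  (forall j, o_P1 P (fun n w =>
     Num.sqrt (k n)%:R * (phat n j w - p j) - NX w 0 j)) ->
  (forall j, o_P1 P (fun n w =>
     Num.sqrt (k n)%:R * (qhat n j w - q j) - NY w 0 j)) ->
  centered_normal_vector NX SigmaX ->
  centered_normal_vector NY SigmaY ->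
  independent_vectors NX NY ->
  (* Dhat is unconstrained where some phat or qhat vanishes *)
  (forall n w, (forall j, phat n j w != 0 /\ qhat n j w != 0) ->
     Dhat n w = sym_divergence (phat n ^~ w) (qhat n ^~ w)) ->
  ((forall j, p j = q j) ->
     cvg_in_distribution P
       (fun n w => (k n)%:R / 2 * Dhat n w)
       (fun w => \sum_j (2 * p j)^-1 * (NX w 0 j - NY w 0 j) ^+ 2)) /\
  ((exists j, p j <> q j) ->
     cvg_in_distribution P
       (fun n w => Num.sqrt (k n)%:R * (Dhat n w - D))
       (fun w => \sum_j (D1 j * NX w 0 j + D2 j * NY w 0 j))).
Proof.
move=> phat qhat D D1 D2 _ _ _ _ _ _ _ p01 q01 _ _ _ _ _ k_oo _ pN qN _ _ _.
move=> DhatE.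
have p0 j : 0 < p j by case/andP: (p01 j).
have q0 j : 0 < q j by case/andP: (q01 j).
pose s n : R := Num.sqrt (k n)%:R.
have mcoord (N : {RV P >-> 'rV[R]_K}) j :
    measurable_fun setT (fun w => N w 0 j).
  exact: (measurable_funPT (coord_rv N j)).
(* One variable dominating all limit coordinates, so that a single truncation [g <= M] bounds them
   together. *)
pose g w : R := \sum_j (`|NX w 0 j| + `|NY w 0 j|).
have mg : measurable_fun setT g.
  by apply: measurable_sum => j; apply: measurable_funD;
    exact: measurableT_comp (mcoord _ _).
have s_oo : s n @[n --> \oo] --> +oo.
  apply/cvgryPge => M.
  have /cvgryPge/(_ (M ^+ 2)) : ((k n)%:R : R) @[n --> \oo] --> +oo.
    exact: (cvg_comp k (GRing.natmul 1) k_oo (@cvgr_idn R)).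
  apply: filterS => n Mk; rewrite (le_trans (ler_norm M))// -sqrtr_sqr.
  exact: ler_wsqrtr.
have o_P1_within M (X' : forall n, 'I_n -> {RV P >-> 'rV[R]_d})
    (N : {RV P >-> 'rV[R]_K}) (p' : 'I_K -> R) j :
    (forall w, `|N w 0 j| <= g w) ->
    o_P1 P (fun n w => s n *
      (empirical_prob r (A j) (k n) (fun i => X' n i w) - p' j) - N w 0 j) ->
    tracks (within [set x : nat * T | g x.2 <= M] (whp P))
      (fun x => s x.1 *
        (empirical_prob r (A j) (k x.1) (fun i => X' x.1 i x.2) - p' j))
      (fun x => N x.2 0 j).
  move=> Ng /o_P1_cvg_whp oN; split.
    apply: cvg_within_filter; apply: oN => n.
    apply: measurable_funB => //; apply: measurable_funM => //.
    by apply: measurable_funB => //; exact: measurable_empirical_prob.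
  by exists M; rewrite near_withinE; apply: nearW => x; exact: le_trans.
have NXg j w : `|NX w 0 j| <= g w.
  rewrite /g (bigD1 j)//= -addrA lerDl addr_ge0//; apply: sumr_ge0 => i _.
  exact: addr_ge0.
have NYg j w : `|NY w 0 j| <= g w.
  rewrite /g (bigD1 j)//= addrAC lerDr addr_ge0//; apply: sumr_ge0 => i _.
  exact: addr_ge0.
have within_s_gt0 M :
    \forall x \near within [set x : nat * T | g x.2 <= M] (whp P), 0 < s x.1.
  have s_gt0 : \forall n \near \oo, 0 < s n by move/cvgryPgt : s_oo; exact.
  have : \forall x \near whp P, 0 < s x.1 by exact: cvg_fst_whp s_gt0.
  by rewrite near_withinE; apply: filterS.
have within_sV0 M :
    (s x.1)^-1 @[x --> within [set x : nat * T | g x.2 <= M] (whp P)] --> 0.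
  have sV0 : (s n)^-1 @[n --> \oo] --> 0 
    by apply/gtr0_cvgV0 => //; move/cvgryPgt : s_oo; exact.
  apply: (cvg_comp fst (fun n => (s n)^-1) _ sV0).
  by apply: cvg_within_filter; exact: cvg_fst_whp.
(* As [p j] and [q j] are positive, consistency keeps all estimators positive with high probability,
   so the arbitrary values of [Dhat] do not affect the limit. *)
have DhatE_near M :
    \forall x \near within [set x : nat * T | g x.2 <= M] (whp P),
    sym_divergence (phat x.1 ^~ x.2) (qhat x.1 ^~ x.2) = Dhat x.1 x.2.
  have : \forall x \near within [set x : nat * T | g x.2 <= M] (whp P),
      forall j, 0 < phat x.1 j x.2 /\ 0 < qhat x.1 j x.2.
    apply: filter_forall => j; apply: filterI.
    - exact: (tracks_gt0 (p0 j) (tracks_scaled_cvg (within_s_gt0 M)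
        (within_sV0 M) (o_P1_within M X NX p j (NXg j) (pN j)))).
    - exact: (tracks_gt0 (q0 j) (tracks_scaled_cvg (within_s_gt0 M)
        (within_sV0 M) (o_P1_within M Y NY q j (NYg j) (qN j)))).
  apply: filterS => x pq.
  by rewrite DhatE// => j; have [? ?] := pq j; rewrite !gt_eqF.
split=> [pq|_].
(* Under the null both samples are centred at the same [p]. *)
- have {}qN j : o_P1 P (fun n w => s n * (qhat n j w - p j) - NY w 0 j).
    by rewrite pq; exact: qN.
  apply: (tracks_within_in_distribution _ _ mg) => [n||M].
  + exact: measurable_funM.
  + apply: measurable_sum => j; apply: measurable_funM => //.
    by apply: measurable_funX; apply: measurable_funB.
  + apply: near_eq_tracks (fun=> erefl) (tracks_sym_divergence_null
      (within_s_gt0 M) (within_sV0 M) p0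
      (fun j => o_P1_within M X NX p j (NXg j) (pN j))
      (fun j => o_P1_within M Y NY p j (NYg j) (qN j))).
    by apply: (filterS _ (DhatE_near M)) => x /= <-; rewrite sqr_sqrtr.
- apply: (tracks_within_in_distribution _ _ mg) => [n||M].
  + by apply: measurable_funM => //; apply: measurable_funB.
  + by apply: measurable_sum => j; apply: measurable_funD;
      apply: measurable_funM.
  + apply: near_eq_tracks (fun=> erefl) (tracks_sym_divergence_alt
      (within_s_gt0 M) (within_sV0 M) p0 q0
      (fun j => o_P1_within M X NX p j (NXg j) (pN j))
      (fun j => o_P1_within M Y NY q j (NYg j) (qN j))).
    by apply: (filterS _ (DhatE_near M)) => x /= <-.
Qed.
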